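(* Let $m,n\ge2$ and let $\Gamma=\langle s\rangle*\langle t\rangle\subseteq\mathrm{PGL}_2(K)$ be a discrete subgroup isomorphic to $C_m*C_n$, with $s$ of order $m$ and $t$ of order $n$, normalised (by conjugation) so that the fixed points of $s$ are $0,\infty$ and the fixed points of $t$ are $1,\lambda$ with $|\lambda|=1$. Then $$|\lambda-1|<\alpha_p(m,n).$$ Conversely, for every $\lambda\in K$ with $|\lambda|=1$, $\lambda\neq1$ and $|\lambda-1|<\alpha_p(m,n)$, there exist $s,t\in\mathrm{PGL}_2(K)$ of orders $m,n$ with fixed points $\{0,\infty\}$ and $\{1,\lambda\}$ respectively such that $\langle s,t\rangle$ is a discrete subgroup of $\mathrm{PGL}_2(K)$ isomorphic to $C_m*C_n$ (via $s,t$).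
   Context: $K$ is a finite extension of $\mathbb{Q}_p$ containing the needed roots of unity, with absolute value $|\cdot|$. For an integer $k$, $\epsilon_k=1$ if $p\mid k$ and $\epsilon_k=0$ otherwise, and $\alpha_p(m,n):=|1-\zeta_p|^{\epsilon_m+\epsilon_n}$ where $\zeta_p$ is a primitive $p$-th root of unity. *)

(* Defs.v *)
From Stdlib Require Import Rdefinitions Raxioms RIneq Rpow_def Rbasic_fun.
From HB Require Import structures.
From mathcomp Require Import all_boot all_order all_algebra.

Set Implicit Arguments.
Unset Strict Implicit.
Unset Printing Implicit Defensive.

Import GRing.Theory.
Local Open Scope ring_scope.

Notation Real := Rdefinitions.R.

Section LocalField.
Variables (K : fieldType) (abs : K -> Real) (p : nat).

Definition is_nonarch_abs : Prop :=
  [/\ (forall x, Rle R0 (abs x)),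
      (forall x, abs x = R0 <-> x = 0),
      (forall x y, abs (x * y) = Rmult (abs x) (abs y)),
      (forall x y, Rle (abs (x + y)) (Rmax (abs x) (abs y)))
    & abs (p%:R) = Rinv (INR p)].

Definition abs_complete : Prop :=
  forall u : nat -> K,
    (forall e, Rlt R0 e -> exists N, forall i j, (N <= i)%N -> (N <= j)%N ->
        Rlt (abs (u i - u j)) e) ->
    exists l, forall e, Rlt R0 e -> exists N, forall i, (N <= i)%N ->
        Rlt (abs (u i - l)) e.

Definition in_Qp (x : K) : Prop :=
  forall e, Rlt R0 e -> exists q : rat, Rlt (abs (x - ratr q)) e.

(* K is a finite extension of Q_p, with |.| extending the p-adic absolute value:
   K has characteristic 0, |.| is a non-archimedean absolute value with
   |p| = 1/p, K is complete, and K is finite-dimensional over the closure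
   of Q in K (which is Q_p). *)
Definition padic_field : Prop :=
  [/\ prime p, [pchar K] =i pred0, is_nonarch_abs, abs_complete &
      exists (d : nat) (b : 'I_d -> K), forall x : K,
        exists a : 'I_d -> K, (forall i, in_Qp (a i)) /\ x = \sum_(i < d) a i * b i].

End LocalField.

Section PGL2.
Variables (K : fieldType).
Implicit Types (A B : 'M[K]_2).

(* equality in PGL_2(K) = GL_2(K) / scalars *)
Definition proj_eq A B : Prop := exists c : K, c != 0 /\ A = c *: B.

Definition pgl_order A (k : nat) : Prop :=
  [/\ (0 < k)%N, proj_eq (A ^+ k) 1 &
      forall j, (0 < j < k)%N -> ~ proj_eq (A ^+ j) 1].

(* the point (x : y) of P^1(K) is fixed by the Moebius transformation A
   (meaningful for (x, y) <> (0, 0)) *)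
Definition fixes A (x y : K) : Prop :=
  exists mu : K,
    A ord0 ord0 * x + A ord0 ord_max * y = mu * x /\
    A ord_max ord0 * x + A ord_max ord_max * y = mu * y.

(* fixed point set of A on P^1(K) is {0, oo}; oo = (1 : 0), z = (z : 1) *)
Definition fixed_pts_0_inf A : Prop :=
  fixes A 1 0 /\ forall z : K, fixes A z 1 <-> z = 0.

Definition fixed_pts_1_lam A (lam : K) : Prop :=
  ~ fixes A 1 0 /\ forall z : K, fixes A z 1 <-> (z = 1 \/ z = lam).

Definition eval_word A B (w : seq (bool * nat)) : 'M[K]_2 :=
  \prod_(x <- w) (if x.1 then A else B) ^+ x.2.

Definition reduced_word (m n : nat) (w : seq (bool * nat)) : Prop :=
  [/\ w != [::],
      sorted (fun a b : bool * nat => a.1 != b.1) w &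
      all (fun x : bool * nat => if x.1 then (0 < x.2 < m)%N else (0 < x.2 < n)%N) w].

(* <s,t> is the free product <s> * <t> (given s, t of orders m, n):
   the natural map C_m * C_n -> <s,t> is injective *)
Definition free_prod_via A B (m n : nat) : Prop :=
  forall w, reduced_word m n w -> ~ proj_eq (eval_word A B w) 1.

(* the group <s,t> (all elements are words, as s, t have finite order) is
   discrete in PGL_2(K): the identity has a neighbourhood (image of a
   neighbourhood of 1 in GL_2(K)) containing no other element of <s,t> *)
Definition discrete_gen (abs : K -> Real) A B : Prop :=
  exists eps, Rlt R0 eps /\ forall w,
    (exists c : K, c != 0 /\ forall i j : 'I_2,
        Rlt (abs (c * (eval_word A B w) i j - (i == j)%:R)) eps) ->
    proj_eq (eval_word A B w) 1.

End PGL2.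

Definition eps_p (p k : nat) : nat := if (p %| k)%N then 1%N else 0%N.

Definition alpha_p (K : fieldType) (abs : K -> Real) (p : nat) (zp : K) (m n : nat) : Real :=
  pow (abs (1 - zp)) (eps_p p m + eps_p p n).

(* Main.v *)
Require Import Defs.
From Stdlib Require Import Rdefinitions Raxioms RIneq Rpow_def Rbasic_fun.
From Stdlib Require Import Rfunctions Lra Classical.
From HB Require Import structures.
From mathcomp Require Import all_boot all_order all_algebra.
From mathcomp Require Import ring.

Set Implicit Arguments.
Unset Strict Implicit.
Unset Printing Implicit Defensive.

Import GRing.Theory.
Local Open Scope ring_scope.
Delimit Scope R_scope with Re.

(** A nontrivial rotation of order dividing [k] fixes in the Bruhat-Tits tree a
    tube around its axis of radius at most [- log r_k], where
    [r_k = |1 - zeta_p| ^ eps_k], and some such rotation attains it.  The axes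
    (0, oo) and (1, lam) are at distance [- log |lam - 1|], so the claim is that
    the group is discrete and free exactly when the two maximal tubes are
    disjoint.

    If they meet, i.e. [|lam - 1| >= r_m r_n], then suitable powers of [s] and
    [t] are simultaneously conjugate to integral matrices.  The residue field is
    finite and (1 + X)^(p^k) tends to 1 for [|X| < 1], so some powers of their
    product tend to the identity, against discreteness and freeness.

    If they are disjoint, the disc [|z - 1| < r_m] and its complement form a
    ping-pong table; following the orbits of the fixed points oo of [s] and 1 of
    [t] keeps every reduced word at distance at least [|lam - 1|] from the
    identity. *)

(** * Ultrametric absolute values *)

Section NonArchimedean.
Variables (K : fieldType) (abs : K -> Real) (p : nat).
Hypotheses (p_pr : prime p) (abs_na : is_nonarch_abs abs p).

Lemma abs_ge0 x : (0 <= abs x)%Re.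
Proof. by case: abs_na. Qed.

Lemma absM x y : abs (x * y) = (abs x * abs y)%Re.
Proof. by case: abs_na. Qed.

Lemma absD_le x y r : (abs x <= r)%Re -> (abs y <= r)%Re -> (abs (x + y) <= r)%Re.
Proof.
by case: abs_na => _ _ _ H _ hx hy; apply: Rle_trans (H x y) (Rmax_lub _ _ _ hx hy).
Qed.

Lemma absD_lt x y r : (abs x < r)%Re -> (abs y < r)%Re -> (abs (x + y) < r)%Re.
Proof.
by case: abs_na => _ _ _ H _ hx hy; apply: Rle_lt_trans (H x y) (Rmax_lub_lt _ _ _ hx hy).
Qed.

Lemma abs_p : abs p%:R = (/ INR p)%Re.
Proof. by case: abs_na. Qed.

Lemma abs_eq0 x : abs x = 0%Re -> x = 0.
Proof. by case: abs_na => _ H _ _ _; case: (H x). Qed.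

Lemma abs0 : abs 0 = 0%Re.
Proof. by case: abs_na => _ H _ _ _; case: (H 0) => _; apply. Qed.

Lemma abs_gt0 x : x != 0 -> (0 < abs x)%Re.
Proof.
move=> x0; case: (Rle_lt_or_eq_dec _ _ (abs_ge0 x)) => // e.
by move: x0; rewrite (abs_eq0 (esym e)) eqxx.
Qed.

Lemma abs1 : abs 1 = 1%Re.
Proof.
have h : (0 < abs 1)%Re by apply: abs_gt0 (oner_neq0 K).
have := absM 1 1.
rewrite mulr1 => e; have : (abs 1 * (abs 1 - 1) = 0)%Re by lra.
by case/Rmult_integral=> ?; lra.
Qed.

Lemma absN x : abs (- x) = abs x.
Proof.
suff h : abs (-1) = 1%Re by rewrite -mulN1r absM h; lra.
have := absM (-1) (-1); rewrite mulrNN mulr1 abs1 => e.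
have h0 := abs_ge0 (-1).
have : ((abs (-1) - 1) * (abs (-1) + 1) = 0)%Re by lra.
by case/Rmult_integral=> ?; lra.
Qed.

Lemma absB x y : abs (x - y) = abs (y - x).
Proof. by rewrite -absN opprB. Qed.

Lemma absB_le x y r : (abs x <= r)%Re -> (abs y <= r)%Re -> (abs (x - y) <= r)%Re.
Proof. by move=> hx hy; apply: absD_le; rewrite ?absN. Qed.

Lemma absB_lt x y r : (abs x < r)%Re -> (abs y < r)%Re -> (abs (x - y) < r)%Re.
Proof. by move=> hx hy; apply: absD_lt; rewrite ?absN. Qed.

(** Isosceles principle: were [x + y] smaller than [y], then [y = (x + y) - x] would be a difference
    of two elements smaller than itself. *)
Lemma absD_dom x y : (abs x < abs y)%Re -> abs (x + y) = abs y.
Proof.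
move=> h; apply: Rle_antisym.
  by apply: absD_le; [apply: Rlt_le | apply: Rle_refl].
apply: Rnot_lt_le => h'.
have := absB_lt h' h; rewrite (addrC x) addrK => ?; lra.
Qed.

Lemma absX x k : abs (x ^+ k) = (abs x ^ k)%Re.
Proof. by elim: k => [|k IH]; rewrite ?expr0 ?abs1 // exprS absM IH. Qed.

Lemma absV x : x != 0 -> abs x^-1 = (/ abs x)%Re.
Proof.
move=> x0; have h := abs_gt0 x0.
have := absM x x^-1; rewrite divff // abs1 => e.
by apply: Rmult_eq_reg_l (Rgt_not_eq _ _ h); rewrite -e Rinv_r //; lra.
Qed.

Lemma abs_sum_le (I : Type) (r : seq I) (P : pred I) (F : I -> K) (b : Real) :
  (0 <= b)%Re -> (forall i, P i -> abs (F i) <= b)%Re ->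
  (abs (\sum_(i <- r | P i) F i) <= b)%Re.
Proof.
move=> b0 hF; apply: (big_ind (fun x => (abs x <= b)%Re)) => //.
  by rewrite abs0.
by move=> x y; apply: absD_le.
Qed.

Lemma abs_sum_lt (I : Type) (r : seq I) (P : pred I) (F : I -> K) (b : Real) :
  (0 < b)%Re -> (forall i, P i -> abs (F i) < b)%Re ->
  (abs (\sum_(i <- r | P i) F i) < b)%Re.
Proof.
move=> b0 hF; apply: (big_ind (fun x => (abs x < b)%Re)) => //.
  by rewrite abs0.
by move=> x y; apply: absD_lt.
Qed.

Lemma absM_le1 x y : (abs x <= 1)%Re -> (abs y <= 1)%Re -> (abs (x * y) <= 1)%Re.
Proof. by move=> hx hy; rewrite absM; have := abs_ge0 x; have := abs_ge0 y; nra. Qed.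

Lemma absM_lt1 x y : (abs x <= 1)%Re -> (abs y < 1)%Re -> (abs (x * y) < 1)%Re.
Proof. by move=> hx hy; rewrite absM; have := abs_ge0 x; have := abs_ge0 y; nra. Qed.

Lemma absX_le1 x k : (abs x <= 1)%Re -> (abs (x ^+ k) <= 1)%Re.
Proof.
by move=> hx; elim: k => [|k IH]; rewrite ?expr0 ?abs1 ?exprS; [lra | apply: absM_le1].
Qed.

Lemma abs_nat_le1 k : (abs k%:R <= 1)%Re.
Proof.
by elim: k => [|k IH]; [rewrite abs0; lra | rewrite -natr1; apply: absD_le; rewrite ?abs1; lra].
Qed.

Lemma abs_int_le1 (z : int) : (abs z%:~R <= 1)%Re.
Proof.
by case: z => k; rewrite ?NegzE ?rmorphN /= ?absN; apply: abs_nat_le1.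
Qed.

Lemma abs_p_lt1 : (0 < abs p%:R < 1)%Re.
Proof.
rewrite abs_p; have : (1 < INR p)%Re by apply: (lt_INR 1); apply/ltP; apply: prime_gt1.
move=> h; split; first by apply: Rinv_0_lt_compat; lra.
by rewrite -Rinv_1; apply: Rinv_lt_contravar; lra.
Qed.

(** By Bezout [u p + v z = 1]. If [z] were small, both terms on the left would have absolute value
    below 1. *)
Lemma abs_int_coprime (z : int) : ~~ (p%:Z %| z)%Z -> abs z%:~R = 1%Re.
Proof.
move=> hz; have : coprimez p%:Z z.
  by rewrite coprimezE /= prime_coprime //; move: hz; rewrite dvdzE.
case/coprimezP=> -[u v] /= e.
have e' : u%:~R * p%:R + v%:~R * z%:~R = 1 :> K.
  by rewrite -[p%:R]/(p%:Z%:~R) -!intrM -intrD e.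
apply: Rle_antisym; first exact: abs_int_le1.
apply: Rnot_lt_le => h.
have h1 : (abs (u%:~R * p%:R) < 1)%Re by apply: absM_lt1 (abs_int_le1 u) _; case: abs_p_lt1.
have h2 : (abs (v%:~R * z%:~R) < 1)%Re by apply: absM_lt1 (abs_int_le1 v) _.
by have := absD_lt h1 h2; rewrite e' abs1; lra.
Qed.

Lemma abs_unity_root z k : (0 < k)%N -> z ^+ k = 1 -> abs z = 1%Re.
Proof.
case: k => // k _ e; case: (Rtotal_order (abs z) 1) => [h|[//|h]]; exfalso.
- have := absM_lt1 (absX_le1 k (Rlt_le _ _ h)) h.
  by rewrite -exprSr e abs1 => ?; lra.
- have := Rlt_pow_R1 _ k.+1 h (elimT ltP (ltn0Sn k)).
  by rewrite -absX e abs1 => ?; lra.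
Qed.

(** The cofactor of [z - 1] in [z ^+ k - 1] is a geometric sum of integral terms. *)
Lemma abs_expr_sub1_le z k : (abs z <= 1)%Re -> (abs (z ^+ k - 1) <= abs (z - 1))%Re.
Proof.
move=> hz; rewrite subrX1 absM -[X in (_ <= X)%Re]Rmult_1_r.
apply: Rmult_le_compat_l; first exact: abs_ge0.
by apply: abs_sum_le => [|i _]; [lra | apply: absX_le1].
Qed.

End NonArchimedean.

(** * Distances from roots of unity to 1 *)

Section RootsOfUnity.
Variables (K : fieldType) (abs : K -> Real) (p : nat) (zp : K).
Hypotheses (p_pr : prime p) (abs_na : is_nonarch_abs abs p).

(* In the Bruhat-Tits tree, [- log (unity_radius k)] is the radius of the
   largest tube around its axis fixed by a nontrivial rotation of order
   dividing [k]. *)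
Definition unity_radius (k : nat) : Real := (abs (1 - zp) ^ eps_p p k)%Re.

Lemma alpha_pE m n : alpha_p abs p zp m n = (unity_radius m * unity_radius n)%Re.
Proof. by rewrite /alpha_p pow_add. Qed.

Variable k : nat.
Hypothesis zp_prim : (p %| k)%N -> p.-primitive_root zp.

Lemma prim_root_neq1 (z : K) q : (1 < q)%N -> q.-primitive_root z -> z != 1.
Proof.
move=> q1 hz; apply/eqP => e; move: (prim_order_dvd hz 1).
by rewrite expr1 e eqxx dvdn1 => /eqP e'; rewrite e' in q1.
Qed.

Lemma unity_radius_gt0_le1 : (0 < unity_radius k <= 1)%Re.
Proof.
rewrite /unity_radius /eps_p; case: ifP => [/zp_prim hz|_] /=; last lra.
rewrite Rmult_1_r; split.
  by apply: (abs_gt0 abs_na); rewrite subr_eq0 eq_sym (prim_root_neq1 (prime_gt1 p_pr)).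
have e := abs_unity_root abs_na (prime_gt0 p_pr) (prim_expr_order hz).
by apply: (absB_le abs_na); rewrite ?(abs1 abs_na) ?e; lra.
Qed.

(** Passing to a power [z'] of prime order [q] can only bring the root closer to 1. If [q = p], then
    [zp] is a power of [z'], hence at least as close to 1. If [q <> p], the powers of [z'] sum to 0,
    so the unit [q] equals minus the sum of the [z' ^+ i - 1], each at most [|z' - 1|]. *)
Lemma unity_root_far z : (0 < k)%N -> z ^+ k = 1 -> z != 1 ->
  (unity_radius k <= abs (z - 1))%Re.
Proof.
move=> k0 zk z1; have [d hd dk] := prim_order_exists k0 zk.
have d1 : (1 < d)%N.
  case: d hd {dk} => [|[|d]] // hd.
  by move: (prim_expr_order hd); rewrite expr1 => e; rewrite e eqxx in z1.
have az : (abs z <= 1)%Re by rewrite (abs_unity_root abs_na k0 zk); lra.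
set q := pdiv d; have q_pr : prime q := pdiv_prime d1.
have hq := dvdn_prim_root hd (pdiv_dvd d); rewrite -/q in hq.
set z' := z ^+ _ in hq.
have az' : (abs z' <= 1)%Re by apply: (absX_le1 abs_na).
apply: Rle_trans (abs_expr_sub1_le abs_na (d %/ q) az); rewrite -/z'.
case: (eqVneq q p) => [qp|qp].
  have pk : (p %| k)%N by rewrite -qp (dvdn_trans (pdiv_dvd d)).
  move: hq; rewrite qp => hq.
  have [i e] : {i : 'I_p | zp = z' ^+ i}.
    exact: (prim_rootP hq (prim_expr_order (zp_prim pk))).
  rewrite /unity_radius /eps_p pk /= Rmult_1_r (absB abs_na 1) e.
  exact: (abs_expr_sub1_le abs_na).
have [_ r1] := unity_radius_gt0_le1; apply: Rle_trans r1 _.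
have <- : abs q%:R = 1%Re.
  by apply: (abs_int_coprime p_pr abs_na (z := q%:Z)); rewrite dvdzE /= dvdn_prime2 // eq_sym.
have z'1 := prim_root_neq1 (prime_gt1 q_pr) hq.
have e : \sum_(i < q) z' ^+ i = 0.
  have := subrX1 z' q; rewrite (prim_expr_order hq) subrr => /esym/eqP.
  by rewrite mulf_eq0 subr_eq0 (negPf z'1) => /eqP.
have -> : q%:R = - \sum_(i < q) (z' ^+ i - 1).
  by rewrite sumrB e sub0r opprK sumr_const card_ord.
rewrite (absN abs_na); apply: (abs_sum_le abs_na); first exact: (abs_ge0 abs_na).
by move=> i _; apply: (abs_expr_sub1_le abs_na).
Qed.

(** If [p] divides [k], then [z ^+ (k %/ p)] is a [p]-th root of unity, thus a power of [zp].
    Otherwise the radius is 1 and [i = 1] will do. *)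
Lemma unity_root_near z : (1 < k)%N -> z ^+ k = 1 ->
  exists2 i, (0 < i < k)%N & (abs (z ^+ i - 1) <= unity_radius k)%Re.
Proof.
move=> k1 zk; have k0 := ltnW k1.
rewrite /unity_radius /eps_p; case: ifP => [pk|_] /=; last first.
  exists 1%N; rewrite ?k1 // expr1; have e := abs_unity_root abs_na k0 zk.
  by apply: (absB_le abs_na); rewrite ?(abs1 abs_na) ?e; lra.
have hz := zp_prim pk; exists (k %/ p)%N.
  by rewrite divn_gt0 ?prime_gt0 // dvdn_leq // ltn_Pdiv // prime_gt1.
have [i ->] : {i : 'I_p | z ^+ (k %/ p) = zp ^+ i}.
  have h : (z ^+ (k %/ p)) ^+ p = 1 by rewrite -exprM divnK.
  exact: (prim_rootP hz h).
rewrite Rmult_1_r (absB abs_na 1); apply: (abs_expr_sub1_le abs_na).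
by rewrite (abs_unity_root abs_na (prime_gt0 p_pr) (prim_expr_order hz)); lra.
Qed.

End RootsOfUnity.

(** * Finite maxima, and the embedding of the rationals in characteristic zero *)

Lemma seq_argmax (I : eqType) (f : I -> Real) (s : seq I) : s != [::] ->
  exists2 i, i \in s & forall j, j \in s -> (f j <= f i)%Re.
Proof.
elim: s => // x [|y s] IH _.
  by exists x => [|j]; rewrite inE // => /eqP ->; apply: Rle_refl.
have [i hi hmax] := IH isT; case: (Rle_lt_dec (f x) (f i)) => h.
  by exists i => [|j]; rewrite inE ?hi ?orbT // => /orP [/eqP -> //|/hmax].
exists x => [|j]; rewrite inE ?eqxx // => /orP [/eqP ->|/hmax hj]; first exact: Rle_refl.
exact: Rle_trans hj (Rlt_le _ _ h).
Qed.

Section RationalsInCharZero.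
Variable K : fieldType.
Hypothesis char0 : [pchar K] =i pred0.

Lemma intr_eq0_pchar0 (z : int) : (z%:~R == 0 :> K) = (z == 0).
Proof.
have [h _] := pcharf0P K.
by case: z => k; rewrite ?NegzE ?rmorphN /= ?oppr_eq0; rewrite -?pmulrn h.
Qed.

(** [ratr] is defined by the reduced fraction; this lets any fraction [a / b] compute it, from which
    additivity and multiplicativity follow by cross-multiplying. *)
Lemma ratrM_denom (q : rat) (a b : int) :
  q * b%:~R = a%:~R -> ratr q * b%:~R = a%:~R :> K.
Proof.
move=> e; have e' : numq q * b = a * denq q.
  apply: (@intr_inj rat); rewrite !intrM -e numqE; ring.
rewrite /ratr; have d0 : (denq q)%:~R != 0 :> K by rewrite intr_eq0_pchar0 denq_neq0.
by apply: (mulIf d0); rewrite -!intrM -e' intrM mulrAC divfK // intrM.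
Qed.

Lemma ratrM_pchar0 (x y : rat) : ratr (x * y) = ratr x * ratr y :> K.
Proof.
have d0 (q : rat) : (denq q)%:~R != 0 :> K by rewrite intr_eq0_pchar0 denq_neq0.
have e : (x * y) * (denq x * denq y)%:~R = (numq x * numq y)%:~R.
  by rewrite !intrM !numqE; ring.
have := ratrM_denom e; rewrite !intrM => e'.
have /mulIf : (denq x)%:~R * (denq y)%:~R != 0 :> K by rewrite mulf_neq0.
by apply; rewrite e' /ratr; field; rewrite !d0.
Qed.

Lemma ratrD_pchar0 (x y : rat) : ratr (x + y) = ratr x + ratr y :> K.
Proof.
have d0 (q : rat) : (denq q)%:~R != 0 :> K by rewrite intr_eq0_pchar0 denq_neq0.
have e : (x + y) * (denq x * denq y)%:~R = (numq x * denq y + numq y * denq x)%:~R.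
  by rewrite intrD !intrM !numqE; ring.
have := ratrM_denom e; rewrite intrD !intrM => e'.
have /mulIf : (denq x)%:~R * (denq y)%:~R != 0 :> K by rewrite mulf_neq0.
by apply; rewrite e' /ratr; field; rewrite !d0.
Qed.

Lemma ratr_eq0_pchar0 (x : rat) : (ratr x == 0 :> K) = (x == 0).
Proof. by rewrite mulf_eq0 invr_eq0 !intr_eq0_pchar0 numq_eq0 (negPf (denq_neq0 x)) orbF. Qed.

End RationalsInCharZero.

(** * Finiteness of the residue field *)

Section FiniteResidueField.
Variables (K : fieldType) (abs : K -> Real) (p : nat).
Hypotheses (p_pr : prime p) (char0 : [pchar K] =i pred0).
Hypothesis abs_na : is_nonarch_abs abs p.

(** With [q = a / b] reduced and integral, [p] cannot divide [b]: it would then not divide [a],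
    giving [|a| = 1] although [a = q b] is small. So [b] has an inverse [v] modulo [p], and [k] is
    the remainder of [a v]. *)
Lemma rat_residue (q : rat) : (abs (ratr q) <= 1)%Re ->
  exists k : 'I_p, (abs (ratr q - k%:R) < 1)%Re.
Proof.
set a := numq q; set b := denq q => hq.
have b0 : b%:~R != 0 :> K by rewrite intr_eq0_pchar0 // denq_neq0.
have ab : ratr q * b%:~R = a%:~R :> K by rewrite /ratr divfK.
have hb : ~~ (p%:Z %| b)%Z.
  apply/negP => pb; have pa : ~~ (p%:Z %| a)%Z.
    apply/negP => pa; have := coprime_num_den q.
    have : (p %| gcdn `|a| `|b|)%N by rewrite dvdn_gcd -!(dvdzE p%:Z) pa pb.
    by rewrite /coprime => hg /eqP e; move: hg p_pr; rewrite [gcdn _ _]e dvdn1 => /eqP ->.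
  have := abs_int_coprime p_pr abs_na pa; rewrite -ab => h1.
  have hb : (abs b%:~R < 1)%Re.
    case/dvdzP: pb => c ->; rewrite intrM.
    by apply: (absM_lt1 abs_na (abs_int_le1 abs_na c)); case: (abs_p_lt1 p_pr abs_na).
  by have := absM_lt1 abs_na hq hb; rewrite h1; lra.
have : coprimez p%:Z b by rewrite coprimezE /= prime_coprime //; move: hb; rewrite dvdzE.
case/coprimezP=> -[u v] /= e.
have e' : u%:~R * p%:R + v%:~R * b%:~R = 1 :> K.
  by rewrite -[p%:R]/(p%:Z%:~R) -!intrM -intrD e.
have p0 : (0 < p)%N := prime_gt0 p_pr.
pose k := `|((a * v)%R %% p%:Z)%Z|%N.
have kE : k%:Z = ((a * v)%R %% p%:Z)%Z.
  by rewrite /k; apply: gez0_abs; apply: modz_ge0; rewrite eqz_nat -lt0n.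
have kp : (k < p)%N by rewrite -ltz_nat kE ltz_pmod // ltz_nat.
exists (Ordinal kp) => /=.
have avE : a%:~R * v%:~R = ((a * v)%R %/ p%:Z)%Z%:~R * p%:R + k%:R :> K.
  by rewrite -intrM {1}(divz_eq (a * v) p%:Z) -kE intrD intrM.
(* Multiplying [q] by the Bezout identity and using [q b = a] exhibits the difference as [p] times
   an integral element. *)
have -> : ratr q - k%:R = (ratr q * u%:~R + ((a * v)%R %/ p%:Z)%Z%:~R) * p%:R :> K.
  have h : ratr q * (u%:~R * p%:R + v%:~R * b%:~R) = ratr q :> K by rewrite e' mulr1.
  by rewrite -{1}h mulrDr [v%:~R * _]mulrC (mulrA _ b%:~R) ab avE; ring.
apply: (absM_lt1 abs_na); last by case: (abs_p_lt1 p_pr abs_na).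
apply: (absD_le abs_na); last exact: (abs_int_le1 abs_na).
by apply: (absM_le1 abs_na) => //; apply: (abs_int_le1 abs_na).
Qed.

Variables (d : nat) (b : 'I_d -> K).
Hypothesis b_span : forall x : K, exists a : 'I_d -> K,
  (forall i, in_Qp abs (a i)) /\ x = \sum_(i < d) a i * b i.

Lemma rat_span_approx (x : K) : exists q : 'I_d -> rat,
  (abs (x - \sum_(i < d) ratr (q i) * b i) < 1)%Re.
Proof.
have [a [aQ ->]] := b_span x.
have /fin_all_exists [q hq] : forall i, exists q : rat, (abs ((a i - ratr q) * b i) < 1)%Re.
  move=> i; have b0 := abs_ge0 abs_na (b i).
  (* This tolerance keeps the error below 1 after multiplication by [b i], even when [b i = 0]. *)
  have e0 : (0 < / (1 + abs (b i)))%Re by apply: Rinv_0_lt_compat; lra.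
  have [q hq] := aQ i _ e0; exists q; rewrite (absM abs_na).
  have : (/ (1 + abs (b i)) * (1 + abs (b i)) = 1)%Re by apply: Rinv_l; lra.
  by have := abs_ge0 abs_na (a i - ratr q); nra.
exists q; rewrite -sumrB; apply: (abs_sum_lt abs_na) => [|i _]; first lra.
by rewrite -mulrBl.
Qed.

(** The [y i] are approximated by rational combinations of [d] elements. More than [d] rational
    coordinate vectors satisfy a linear relation, which is divided by a coefficient of largest
    absolute value. *)
Lemma residue_dependent N (y : 'I_N -> K) : (d < N)%N -> exists q : 'I_N -> rat,
  [/\ forall i, (abs (ratr (q i)) <= 1)%Re, exists i, abs (ratr (q i)) = 1%Re
    & (abs (\sum_i ratr (q i) * y i) < 1)%Re].
Proof.
move=> dN; have r0 : ratr 0 = 0 :> K := ratr_nat K 0.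
have /fin_all_exists [a ha] i := rat_span_approx (y i).
pose A := \matrix_(i < N, j < d) a i j.
have : kermx A != 0.
  rewrite -mxrank_eq0 mxrank_ker subn_eq0 -ltnNge.
  exact: leq_ltn_trans (rank_leq_col A) dN.
case/rowV0Pn => c /sub_kermxP cA c0.
have [i0 _ hmax] : exists2 i, i \in enum 'I_N
    & forall j, j \in enum 'I_N -> (abs (ratr (c 0%R j)) <= abs (ratr (c 0%R i)))%Re.
  by apply: seq_argmax; rewrite -size_eq0 size_enum_ord; case: N dN {y a ha A c cA c0}.
have ci0 : c 0%R i0 != 0.
  apply: contra c0 => /eqP e; apply/eqP/rowP => j; rewrite mxE; apply/eqP.
  rewrite -(ratr_eq0_pchar0 char0); apply/eqP/(abs_eq0 abs_na)/Rle_antisym.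
    have := hmax j; rewrite mem_enum e => /(_ isT).
    by rewrite r0 (abs0 abs_na).
  exact: (abs_ge0 abs_na).
have qE j : ratr (c 0%R j / c 0%R i0) * ratr (c 0%R i0) = ratr (c 0%R j) :> K.
  by rewrite -(ratrM_pchar0 char0) divfK.
have ci0' : (0 < abs (ratr (c 0%R i0)))%Re by apply: (abs_gt0 abs_na); rewrite ratr_eq0_pchar0.
have q1 j : (abs (ratr (c 0%R j / c 0%R i0)) <= 1)%Re.
  have := hmax j; rewrite mem_enum => /(_ isT); rewrite -(qE j) (absM abs_na) => h.
  by apply: Rmult_le_reg_r ci0' _; lra.
exists (fun j => c 0%R j / c 0%R i0); split=> //.
  exists i0; rewrite divff //; rewrite -[1]/(1%:R) ratr_nat; exact: (abs1 abs_na).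
(* The relation annihilates the approximations, so each [y i] may be replaced by its approximation
   error. *)
have -> : \sum_i ratr (c 0%R i / c 0%R i0) * y i =
   \sum_i ratr (c 0%R i / c 0%R i0) * (y i - \sum_(j < d) ratr (a i j) * b j).
  under [RHS]eq_bigr do rewrite mulrBr mulr_sumr.
  rewrite sumrB exchange_big /= (_ : \sum_(j < d) _ = 0) ?subr0 //.
  apply: big1 => j _.
  under eq_bigr do rewrite mulrA -(ratrM_pchar0 char0).
  rewrite -mulr_suml.
  have rsum (F : 'I_N -> rat) : \sum_i ratr (F i) = ratr (\sum_i F i) :> K.
    apply: esym; apply: (big_morph (@ratr K)); last exact: r0.
    exact: ratrD_pchar0.
  rewrite rsum (_ : \sum_i _ = 0); last first.
    under eq_bigr do rewrite mulrAC.
    rewrite -mulr_suml; have /matrixP /(_ 0%R j) := cA; rewrite !mxE.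
    by under eq_bigr do rewrite mxE; move=> ->; rewrite mul0r.
  by rewrite r0 mul0r.
by apply: (abs_sum_lt abs_na) => [|i _]; [lra | apply: (absM_lt1 abs_na)].
Qed.

(** Linear independence of the residues of the [y i] over the prime field, whose elements are
    represented by the integral rationals. *)
Definition residue_independent k (y : 'I_k -> K) : Prop :=
  (forall i, (abs (y i) <= 1)%Re) /\
  forall q : 'I_k -> rat, (forall i, (abs (ratr (q i)) <= 1)%Re) ->
    (abs (\sum_i ratr (q i) * y i) < 1)%Re -> forall i, (abs (ratr (q i)) < 1)%Re.

Lemma residue_independent_maximal : exists k,
  (exists y : 'I_k -> K, residue_independent y) /\
  ~ (exists y : 'I_k.+1 -> K, residue_independent y).
Proof.
apply: NNPP => H.
have all_k k : exists y : 'I_k -> K, residue_independent y.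
  elim: k => [|k IH]; first by exists (fun=> 0); split=> [[]|q _ _ []].
  by apply: NNPP => h; apply: H; exists k.
have [y [_ yi]] := all_k d.+1.
have [q [q1 [i qi] hq]] := residue_dependent y (ltnSn d).
by have := yi q q1 hq i; lra.
Qed.

(** A maximal independent family is a basis of the residue field over the prime field, so sums of
    the [y i] with coefficients in ['I_p] represent every residue. *)
Lemma finite_residues : exists (I : finType) (rep : I -> K),
  forall x, (abs x <= 1)%Re -> exists i, (abs (x - rep i) < 1)%Re.
Proof.
have [k [[y [y1 yi]] kmax]] := residue_independent_maximal.
exists {ffun 'I_k -> 'I_p}, (fun f : {ffun 'I_k -> 'I_p} => \sum_i (f i)%:R * y i) => x x1.
pose y' (i : 'I_k.+1) := oapp y x (unlift ord0 i).
have y'0 : y' ord0 = x by rewrite /y' unlift_none.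
have y'S i : y' (lift ord0 i) = y i by rewrite /y' liftK.
have : ~ residue_independent y' by move=> h; apply: kmax; exists y'.
move=> /not_and_or [[]|]; first by move=> i; rewrite /y'; case: unliftP => [j _|_] /=; [exact: y1|exact: x1].
move=> /not_all_ex_not [q] hq0.
have [q1 hq1] := imply_to_and _ _ hq0; have [hq hq2] := imply_to_and _ _ hq1.
have [i0 hi0] := not_all_ex_not _ _ hq2.
move: hq; rewrite big_ord_recl y'0; under eq_bigr do rewrite y'S.
set c := q ord0 => hq.
(* A small coefficient of [x] could be dropped, leaving a nontrivial relation among the independent
   [y i]. *)
have c1 : abs (ratr c) = 1%Re.
  apply: Rle_antisym; first exact: q1.
  apply: Rnot_lt_le => hc; apply: hi0.
  have cx : (abs (ratr c * x) < 1)%Re by rewrite mulrC; apply: (absM_lt1 abs_na).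
  have := absB_lt abs_na hq cx; rewrite addrC addKr => hs.
  have [j ->|->] := unliftP ord0 i0; last exact: hc.
  exact: (yi (fun j => q (lift ord0 j)) _ hs).
have c0 : ratr c != 0 :> K.
  by apply/eqP => e; move: c1; rewrite e (abs0 abs_na); lra.
have c0' : c != 0 by rewrite -(ratr_eq0_pchar0 char0).
have qE (r : rat) : ratr (r / c) * ratr c = ratr r :> K.
  by rewrite -(ratrM_pchar0 char0) divfK.
have /fin_all_exists [f hf] : forall j : 'I_k, exists i : 'I_p,
    (abs (ratr (- q (lift ord0 j) / c) - i%:R) < 1)%Re.
  move=> j; apply: rat_residue.
  have := congr1 abs (qE (- q (lift ord0 j))); rewrite (absM abs_na) c1 Rmult_1_r => ->.
  have -> : ratr (- q (lift ord0 j)) = - ratr (q (lift ord0 j)) :> K.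
    by rewrite /ratr numqN denqN rmorphN mulNr.
  by rewrite (absN abs_na).
exists (finfun f).
(* Solve the relation for [x] by dividing by the unit [c], then replace the coefficients by their
   residues [f i]; both resulting errors are small. *)
have -> : x - \sum_i (finfun f i)%:R * y i =
    (ratr c * x + \sum_i ratr (q (lift ord0 i)) * y i) / ratr c
    + \sum_i (ratr (- q (lift ord0 i) / c) - (f i)%:R) * y i.
  under [X in _ / ratr c + X]eq_bigr do rewrite mulrBl.
  rewrite sumrB.
  rewrite addrA; congr (_ - _); last by apply: eq_bigr => i _; rewrite ffunE.
  have -> : \sum_i ratr (- q (lift ord0 i) / c) * y i =
      - (\sum_i ratr (q (lift ord0 i)) * y i) / ratr c.
    rewrite mulNr mulr_suml -sumrN; apply: eq_bigr => i _.
    have -> : ratr (- q (lift ord0 i) / c) = - ratr (q (lift ord0 i) / c) :> K.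
      by rewrite mulNr /ratr numqN denqN rmorphN mulNr.
    by rewrite -(qE (q _)); field.
  by field.
apply: (absD_lt abs_na).
  by rewrite mulrC; apply: (absM_lt1 abs_na) => //; rewrite (absV abs_na) // c1 Rinv_1; lra.
apply: (abs_sum_lt abs_na) => [|i _]; first lra.
by rewrite mulrC; apply: (absM_lt1 abs_na).
Qed.

End FiniteResidueField.

(** * Powers of integral matrices approaching the identity *)

Section IntegralMatrices.
Variables (K : fieldType) (abs : K -> Real) (p : nat).
Hypotheses (p_pr : prime p) (abs_na : is_nonarch_abs abs p).

Definition mx_bounded (r : Real) (A : 'M[K]_2) : Prop :=
  forall i j, (abs (A i j) <= r)%Re.

Lemma mx_boundedD r A B : mx_bounded r A -> mx_bounded r B -> mx_bounded r (A + B).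
Proof. by move=> hA hB i j; rewrite mxE; apply: (absD_le abs_na). Qed.

Lemma mx_boundedM r r' A B : (0 <= r)%Re -> (0 <= r')%Re ->
  mx_bounded r A -> mx_bounded r' B -> mx_bounded (r * r')%Re (A * B).
Proof.
move=> r0 r0' hA hB i j; rewrite mxE; apply: (abs_sum_le abs_na) => [|k _].
  exact: Rmult_le_pos.
by rewrite (absM abs_na); apply: Rmult_le_compat; rewrite //; apply: (abs_ge0 abs_na).
Qed.

Lemma mx_bounded_le r r' A : (r <= r')%Re -> mx_bounded r A -> mx_bounded r' A.
Proof. by move=> h hA i j; apply: Rle_trans (hA i j) h. Qed.

Lemma mx_bounded_nat k r : (abs k%:R <= r)%Re -> mx_bounded r k%:R.
Proof.
move=> hk i j; rewrite -(rmorph_nat (@scalar_mx K 2)) mxE.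
by case: eqP => _ //; rewrite (abs0 abs_na); apply: Rle_trans (abs_ge0 abs_na _) hk.
Qed.

Lemma mx_bounded1 : mx_bounded 1 1.
Proof. by apply: (mx_bounded_nat (k := 1)); rewrite (abs1 abs_na); lra. Qed.

Lemma mx_boundedX A k : mx_bounded 1 A -> mx_bounded 1 (A ^+ k).
Proof.
move=> hA; elim: k => [|k IH]; first by rewrite expr0; apply: mx_bounded1.
by rewrite exprS -[1%Re]Rmult_1_r; apply: mx_boundedM => //; lra.
Qed.

Lemma mx_bounded_sum (I : Type) (s : seq I) (F : I -> 'M[K]_2) r : (0 <= r)%Re ->
  (forall i, mx_bounded r (F i)) -> mx_bounded r (\sum_(i <- s) F i).
Proof. by move=> r0 hF i j; rewrite summxE; apply: (abs_sum_le abs_na) => // k _; apply: hF. Qed.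

Lemma mx_bounded_expr_sub1 r Y k : (0 <= r <= 1)%Re ->
  mx_bounded r (Y - 1) -> mx_bounded r (Y ^+ k - 1).
Proof.
move=> r01 hY; rewrite subrX1 -[r]Rmult_1_r; apply: mx_boundedM => //; try lra.
apply: mx_bounded_sum => [|i]; first lra.
apply: mx_boundedX; rewrite -[Y](subrK 1); apply: mx_boundedD mx_bounded1.
by apply: mx_bounded_le hY; lra.
Qed.

(** The cofactor of [Y - 1] in [Y ^+ p - 1] is [p] plus the sum of the [Y ^+ i - 1], so it
    contributes a factor [max(|p|, r)]. *)
Lemma mx_bounded_frobenius r Y : (0 <= r <= 1)%Re ->
  mx_bounded r (Y - 1) -> mx_bounded (r * Rmax (abs p%:R) r) (Y ^+ p - 1).
Proof.
move=> r01 hY; have [pl pr] := (Rmax_l (abs p%:R) r, Rmax_r (abs p%:R) r).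
rewrite subrX1; apply: mx_boundedM => //; try lra.
have -> : \sum_(i < p) Y ^+ i = \sum_(i < p) (Y ^+ i - 1) + p%:R.
  by rewrite sumrB sumr_const card_ord subrK.
apply: mx_boundedD; last exact: mx_bounded_nat.
apply: mx_bounded_sum => [|i]; first lra.
by apply: mx_bounded_le pr _; apply: mx_bounded_expr_sub1.
Qed.

(** Each [p]-th power shrinks the bound by at least the fixed ratio [th = max(|p|, r) < 1]. *)
Lemma one_unit_pow_cvg1 r Y e : (0 <= r < 1)%Re -> (0 < e)%Re -> mx_bounded r (Y - 1) ->
  exists k, mx_bounded e (Y ^+ (p ^ k) - 1).
Proof.
move=> r01 e0 hY; have [p0 p1] := abs_p_lt1 p_pr abs_na.
set th := Rmax (abs p%:R) r.
have [pl pr] : (abs p%:R <= th)%Re /\ (r <= th)%Re by split; [apply: Rmax_l | apply: Rmax_r].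
have th1 : (th < 1)%Re by apply: Rmax_lub_lt; lra.
have pow1 k : (0 <= th ^ k <= 1)%Re.
  by elim: k => [|k IH] /=; nra.
have hk k : mx_bounded (r * th ^ k) (Y ^+ (p ^ k) - 1).
  elim: k => [|k IH]; first by rewrite expn0 expr1 /= Rmult_1_r.
  rewrite expnSr exprM; have := pow1 k => -[t0 t1].
  have rk : (0 <= r * th ^ k <= r)%Re by nra.
  apply: mx_bounded_le (mx_bounded_frobenius _ IH); last lra.
  have -> : (r * th ^ k.+1 = r * th ^ k * th)%Re by rewrite /=; lra.
  by apply: Rmult_le_compat_l; [lra | apply: Rmax_lub; lra].
have [k hpow] := pow_lt_1_zero th ltac:(rewrite Rabs_pos_eq; lra) e e0.
exists k; apply: mx_bounded_le (hk k); have [t0 t1] := pow1 k.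
by have := hpow k (le_n k); rewrite Rabs_pos_eq //; nra.
Qed.

Hypothesis residues_fin : exists (I : finType) (rep : I -> K),
  forall x, (abs x <= 1)%Re -> exists i, (abs (x - rep i) < 1)%Re.

(** Pigeonhole: there are finitely many residue matrices, so two powers [A ^+ u] and [A ^+ v] are
    congruent; multiplying their difference by the integral inverse of [A ^+ u] gives
    [N = v - u]. *)
Lemma integral_pow_one_unit A A' : mx_bounded 1 A -> mx_bounded 1 A' -> A * A' = 1 ->
  exists N r, [/\ (0 < N)%N, (0 <= r < 1)%Re & mx_bounded r (A ^+ N - 1)].
Proof.
move=> hA hA' AA'; have [I [rep hrep]] := residues_fin.
pose M := #|{ffun 'I_2 * 'I_2 -> I}|.+1.
have /fin_all_exists [f hf] : forall k : 'I_M, exists g : {ffun 'I_2 * 'I_2 -> I},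
    forall i j, (abs ((A ^+ k) i j - rep (g (i, j))) < 1)%Re.
  move=> k; have /fin_all_exists [g hg] : forall ij : 'I_2 * 'I_2, exists c : I,
      (abs ((A ^+ k) ij.1 ij.2 - rep c) < 1)%Re.
    by move=> ij; apply: hrep; apply: mx_boundedX.
  by exists (finfun g) => i j; rewrite ffunE; apply: (hg (i, j)).
have [u [v [uv fuv]]] : exists u v : 'I_M, (u < v)%N /\ f u = f v.
  apply: NNPP => H; have /leq_card : injective f.
    move=> u v e; apply/val_inj; case: (ltngtP u v) => // h; exfalso; apply: H.
      by exists u, v.
    by exists v, u.
  by rewrite card_ord ltnn.
pose D := A ^+ (v - u) - 1.
have DE : D = A' ^+ u * (A ^+ v - A ^+ u).
  have A'A : A' * A = 1 by apply: mulmx1C.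
  have e : A' ^+ u * A ^+ u = 1.
    by rewrite -exprMn_comm ?A'A ?expr1n // /GRing.comm A'A.
  by rewrite -{1}(subnKC (ltnW uv)) exprD -{2}[A ^+ u]mulr1 -mulrBr mulrA e mul1r.
have D1 i j : (abs (D i j) < 1)%Re.
  rewrite DE mxE; apply: (abs_sum_lt abs_na) => [|k _]; first lra.
  apply: (absM_lt1 abs_na); first exact: mx_boundedX.
  have -> : (A ^+ v - A ^+ u) k j =
     ((A ^+ v) k j - rep (f v (k, j))) - ((A ^+ u) k j - rep (f u (k, j))).
    by rewrite !mxE fuv; ring.
  by apply: (absB_lt abs_na); apply: hf.
(* The uniform bound [r < 1] is the largest absolute value of an entry of [D]. *)
have [[i0 j0] _ hmax] : exists2 ij, ij \in enum {: 'I_2 * 'I_2}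
    & forall ij', ij' \in enum {: 'I_2 * 'I_2} -> (abs (D ij'.1 ij'.2) <= abs (D ij.1 ij.2))%Re.
  apply: (seq_argmax (fun ij : 'I_2 * 'I_2 => abs (D ij.1 ij.2))).
  by rewrite -size_eq0 -cardE card_prod card_ord.
exists (v - u)%N, (abs (D i0 j0)); split; rewrite ?subn_gt0 //.
  by split=> //; apply: (abs_ge0 abs_na).
by move=> i j; apply: (hmax (i, j)); rewrite mem_enum.
Qed.

Lemma integral_pow_near1 A A' e : (0 < e)%Re ->
  mx_bounded 1 A -> mx_bounded 1 A' -> A * A' = 1 ->
  exists2 N, (0 < N)%N & mx_bounded e (A ^+ N - 1).
Proof.
move=> e0 hA hA' AA'; have [N [r [N0 r01 hr]]] := integral_pow_one_unit hA hA' AA'.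
have [k hk] := one_unit_pow_cvg1 r01 e0 hr.
by exists (N * p ^ k)%N; rewrite ?exprM // muln_gt0 N0 expn_gt0 prime_gt0.
Qed.

End IntegralMatrices.

(** * Explicit two by two matrices and rotations with given fixed points *)

Section TwoByTwo.
Variable K : fieldType.
Implicit Types (A B : 'M[K]_2) (a b c d e : K).

Definition mx2 a b c d : 'M[K]_2 := \matrix_(i, j)
  (if i == ord0 then if j == ord0 then a else b else if j == ord0 then c else d).

Lemma ord2_case (i : 'I_2) : i = ord0 \/ i = ord_max.
Proof. by case: i => [[|[|]]] // h; [left | right]; apply: val_inj. Qed.

Lemma mx2_eta A : A = mx2 (A ord0 ord0) (A ord0 ord_max) (A ord_max ord0) (A ord_max ord_max).
Proof.
by apply/matrixP => i j; rewrite mxE; case: (ord2_case i) => ->; case: (ord2_case j) => ->.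
Qed.

Lemma mx2E a b c d : [/\ mx2 a b c d ord0 ord0 = a, mx2 a b c d ord0 ord_max = b,
  mx2 a b c d ord_max ord0 = c & mx2 a b c d ord_max ord_max = d].
Proof. by rewrite !mxE. Qed.

Lemma mx2_inj a b c d a' b' c' d' : mx2 a b c d = mx2 a' b' c' d' ->
  [/\ a = a', b = b', c = c' & d = d'].
Proof.
move/matrixP => e; have [a1 b1 c1 d1] := mx2E a b c d.
have [a2 b2 c2 d2] := mx2E a' b' c' d'.
by split; [rewrite -a2 -a1 | rewrite -b2 -b1 | rewrite -c2 -c1 | rewrite -d2 -d1]; apply: e.
Qed.

Lemma mul_mx2 a b c d a' b' c' d' : mx2 a b c d * mx2 a' b' c' d' =
  mx2 (a * a' + b * c') (a * b' + b * d') (c * a' + d * c') (c * b' + d * d').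
Proof.
rewrite (mx2_eta (_ * _)) !mxE !big_ord_recl !big_ord0 !addr0.
by rewrite (_ : lift ord0 ord0 = ord_max) ?mxE //; apply: val_inj.
Qed.

Lemma scale_mx2 e a b c d : e *: mx2 a b c d = mx2 (e * a) (e * b) (e * c) (e * d).
Proof. by rewrite (mx2_eta (_ *: _)) !mxE. Qed.

Lemma mx2_1 : 1 = mx2 1 0 0 1.
Proof. by rewrite (mx2_eta 1) !mxE. Qed.

Lemma det_mx2 a b c d : \det (mx2 a b c d) = a * d - b * c.
Proof.
rewrite (expand_det_row _ ord0) !big_ord_recl big_ord0 /cofactor !det_mx11 !mxE /=.
by rewrite expr0 expr1; ring.
Qed.

Definition rot_0_inf e := mx2 e 0 0 1.

Lemma rot_0_infX e k : rot_0_inf e ^+ k = rot_0_inf (e ^+ k).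
Proof.
elim: k => [|k IH]; first by rewrite !expr0 mx2_1.
by rewrite exprS IH mul_mx2 exprS; congr mx2; ring.
Qed.

Lemma rot_0_inf_scalar e : proj_eq (rot_0_inf e) 1 -> e = 1.
Proof.
by case=> c [_]; rewrite mx2_1 scale_mx2 => /mx2_inj [-> _ _ <-].
Qed.

Variable lam : K.
Hypothesis lam1 : lam != 1.

Let mu0 : 1 - lam != 0. Proof. by rewrite subr_eq0 eq_sym. Qed.

(* Eigenvalue [e] on (1 : 1) and eigenvalue 1 on (lam : 1). *)
Definition rot_1_lam e :=
  let k := (e - 1) / (1 - lam) in mx2 (1 + k) (e - 1 - k) k (e - k).

Lemma rot_1_lamM e e' : rot_1_lam e * rot_1_lam e' = rot_1_lam (e * e').
Proof. by rewrite mul_mx2; congr mx2; field. Qed.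

Lemma rot_1_lamX e k : rot_1_lam e ^+ k = rot_1_lam (e ^+ k).
Proof.
elim: k => [|k IH]; last by rewrite !exprS IH rot_1_lamM.
by rewrite !expr0 mx2_1 /rot_1_lam subrr mul0r !subr0 addr0.
Qed.

Lemma rot_1_lam_scalar e : proj_eq (rot_1_lam e) 1 -> e = 1.
Proof.
case=> c [_]; rewrite mx2_1 scale_mx2 => /mx2_inj [_ _ /eqP + _].
by rewrite mulr0 mulf_eq0 invr_eq0 (negPf mu0) orbF subr_eq0 => /eqP.
Qed.

Lemma proj_eqZ c A B : c != 0 -> proj_eq (c *: A) B <-> proj_eq A B.
Proof.
move=> c0; split=> -[k [k0 e]].
  exists (c^-1 * k); split; first by rewrite mulf_neq0 // invr_neq0.
  by rewrite -scalerA -e scalerA mulVf // scale1r.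
by exists (c * k); split; [rewrite mulf_neq0 | rewrite e scalerA].
Qed.

(** Fixed points are eigenvectors, so [A] is diagonal; [e] is the ratio of the eigenvalues at oo and
    0. *)
Lemma fixed_pts_0_infE A : A \in unitmx -> fixed_pts_0_inf A ->
  exists c e, c != 0 /\ A = c *: rot_0_inf e.
Proof.
move=> uA [[m1 [_ h1]] /(_ 0) [_ /(_ erefl) [m2 [h2 _]]]].
move: h1 h2; rewrite !mulr0 mulr1 add0r addr0 mulr1 => h1 h2.
move: uA; rewrite (mx2_eta A) h1 h2 unitmxE det_mx2 mulr0 subr0 unitfE mulf_eq0.
case/norP => a0 d0; exists (A ord_max ord_max), (A ord0 ord0 / A ord_max ord_max).
by split=> //; rewrite scale_mx2; congr mx2; rewrite ?mulr0 ?mulr1 // mulrC divfK.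
Qed.

(** Here [e] is the ratio of the eigenvalues [m1] at 1 and [m2] at [lam]; [m2 = 0] would make the
    determinant vanish. *)
Lemma fixed_pts_1_lamE A : A \in unitmx -> fixed_pts_1_lam A lam ->
  exists c e, c != 0 /\ A = c *: rot_1_lam e.
Proof.
move=> uA [_ fx]; have [_ /(_ (or_introl erefl)) [m1 [h1 h2]]] := fx 1.
have [_ /(_ (or_intror erefl)) [m2 [h3 h4]]] := fx lam.
move: uA h1 h2 h3 h4; rewrite (mx2_eta A) unitmxE det_mx2 unitfE.
have [-> -> -> ->] := mx2E (A ord0 ord0) (A ord0 ord_max) (A ord_max ord0) (A ord_max ord_max).
move: (A ord0 ord0) (A ord0 ord_max) (A ord_max ord0) (A ord_max ord_max) => a b c d.
rewrite !mulr1 => det0 h1 h2 h3 h4.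
have m20 : m2 != 0.
  apply: contra det0 => /eqP m0.
  have -> : b = m2 * lam - a * lam by rewrite -h3; ring.
  have -> : d = m2 - c * lam by rewrite -h4; ring.
  by apply/eqP; rewrite m0; ring.
exists m2, (m1 / m2); split=> //.
have cE : c = (m1 - m2) / (1 - lam).
  by apply: (mulIf mu0); rewrite divfK // -h2 -h4; ring.
have aE : a = (m1 - m2 * lam) / (1 - lam).
  by apply: (mulIf mu0); rewrite divfK // -h1 -h3; ring.
have bE : b = m1 - a by rewrite -h1; ring.
have dE : d = m1 - c by rewrite -h2; ring.
by rewrite /rot_1_lam scale_mx2 dE bE aE cE; congr mx2; field; rewrite mu0 m20.
Qed.

End TwoByTwo.

(** * Words in the two generators *)

Section Words.
Variable K : fieldType.
Implicit Types (A B : 'M[K]_2).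

Lemma eval_word_nil A B : eval_word A B [::] = 1.
Proof. exact: big_nil. Qed.

Lemma eval_word_cons A B x w :
  eval_word A B (x :: w) = (if x.1 then A else B) ^+ x.2 * eval_word A B w.
Proof. exact: big_cons. Qed.

Definition alternating_word N i j : seq (bool * nat) :=
  flatten (nseq N [:: (true, i); (false, j)]).

Lemma eval_alternating_word A B N i j :
  eval_word A B (alternating_word N i j) = (A ^+ i * B ^+ j) ^+ N.
Proof.
elim: N => [|N IH]; first exact: eval_word_nil.
by rewrite /alternating_word /= !eval_word_cons IH /= exprS mulrA.
Qed.

(** With this, freeness forbids any positive power of [A ^+ i * B ^+ j] from being scalar. *)
Lemma reduced_alternating_word m n N i j : (0 < i < m)%N -> (0 < j < n)%N -> (0 < N)%N ->
  reduced_word m n (alternating_word N i j).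
Proof.
move=> hi hj; case: N => // N _; split=> //=.
  by rewrite -/(alternating_word N i j); elim: N => //= N ->.
rewrite hi hj /= -/(alternating_word N i j); elim: N => //= N ->.
by rewrite hi hj.
Qed.

End Words.

(** * Necessity of the bound *)

Section Necessity.
Variables (K : fieldType) (abs : K -> Real) (p m n : nat) (zp lam : K).
Hypotheses (padic : padic_field abs p) (m2 : (2 <= m)%N) (n2 : (2 <= n)%N).
Hypothesis zp_prim : ((p %| m) || (p %| n))%N -> p.-primitive_root zp.

Let p_pr : prime p. Proof. by case: padic. Qed.
Let abs_na : is_nonarch_abs abs p. Proof. by case: padic. Qed.
Let zp_m : (p %| m)%N -> p.-primitive_root zp.
Proof. by move=> h; apply: zp_prim; rewrite h. Qed.
Let zp_n : (p %| n)%N -> p.-primitive_root zp.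
Proof. by move=> h; apply: zp_prim; rewrite h orbT. Qed.

Lemma unity_inv_sub1 (w : K) : abs w = 1%Re ->
  abs w^-1 = 1%Re /\ abs (w^-1 - 1) = abs (w - 1).
Proof.
move=> w1; have w0 : w != 0.
  by apply/eqP => e; move: w1; rewrite e (abs0 abs_na); lra.
have wV : abs w^-1 = 1%Re by rewrite (absV abs_na) // w1 Rinv_1.
split=> //; have -> : w^-1 - 1 = - ((w - 1) * w^-1) by field.
by rewrite (absN abs_na) (absM abs_na) wV Rmult_1_r.
Qed.

(* On the disc of centre 1 and radius |rho| both rotations act integrally, so
   their product has powers arbitrarily close to the identity. *)
Lemma rotation_product_pow_near1 (rho w e : K) eps : (0 < eps)%Re -> lam != 1 ->
  (0 < abs rho <= 1)%Re -> abs w = 1%Re -> abs e = 1%Re ->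
  (abs (w - 1) <= abs rho)%Re -> (abs (e - 1) * abs rho <= abs (lam - 1))%Re ->
  exists2 N, (0 < N)%N & forall i j,
    (abs (((rot_0_inf w * rot_1_lam lam e) ^+ N - 1) i j) < eps)%Re.
Proof.
move=> eps0 lam1 [rho0 rho1] w1 e1 hw he.
have rhoN0 : rho != 0 by apply/eqP => h; move: rho0; rewrite h (abs0 abs_na); lra.
have mu0 : 1 - lam != 0 by rewrite subr_eq0 eq_sym.
have w0 : w != 0 by apply/eqP => h; move: w1; rewrite h (abs0 abs_na); lra.
have e0 : e != 0 by apply/eqP => h; move: e1; rewrite h (abs0 abs_na); lra.
(* [S] and [T] are the two rotations conjugated by [G : z |-> rho z + 1], which carries the unit
   disc to the disc of centre 1 and radius [|rho|]. *)
pose S x := mx2 x ((x - 1) / rho) 0 1.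
pose T x := mx2 1 0 ((x - 1) * rho / (1 - lam)) x.
have bounded2 r a b c d : (abs a <= r -> abs b <= r -> abs c <= r -> abs d <= r ->
    mx_bounded abs r (mx2 a b c d))%Re.
  move=> ha hb hc hd i j; have [a1 b1 c1 d1] := mx2E a b c d.
  by case: (ord2_case i) => ->; case: (ord2_case j) => ->; rewrite ?a1 ?b1 ?c1 ?d1.
have a01 : (abs 0 <= 1)%Re by rewrite (abs0 abs_na); lra.
have a11 : (abs 1 <= 1)%Re by rewrite (abs1 abs_na); lra.
have div_le1 x y : y != 0 -> (abs x <= abs y)%Re -> (abs (x / y) <= 1)%Re.
  move=> y0 h; have hy := abs_gt0 abs_na y0.
  rewrite (absM abs_na) (absV abs_na) //; apply: (Rmult_le_reg_r (abs y)) => //.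
  by rewrite Rmult_assoc Rinv_l; lra.
have bS x : abs x = 1%Re -> abs (x - 1) = abs (w - 1) -> mx_bounded abs 1 (S x).
  move=> x1 hx; have x1' : (abs x <= 1)%Re by lra.
  by apply: bounded2 => //; apply: div_le1; rewrite ?hx.
have bT x : abs x = 1%Re -> abs (x - 1) = abs (e - 1) -> mx_bounded abs 1 (T x).
  move=> x1 hx; have x1' : (abs x <= 1)%Re by lra.
  by apply: bounded2 => //; apply: div_le1 => //; rewrite (absM abs_na) hx (absB abs_na 1).
have bM A B : mx_bounded abs 1 A -> mx_bounded abs 1 B -> mx_bounded abs 1 (A * B).
  by move=> hA hB; rewrite -[1%Re]Rmult_1_r; apply: (mx_boundedM abs_na) => //; lra.
have [wV1 wVE] := unity_inv_sub1 w1; have [eV1 eVE] := unity_inv_sub1 e1.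
(* The inverse [A'] is integral too, since inverting a unit preserves its distance to 1. *)
set A := S w * T e; pose A' := T e^-1 * S w^-1.
have AA' : A * A' = 1.
  rewrite /A /A' -mulrA (mulrA (T e)) [T e * _]mul_mx2.
  rewrite [X in S w * (X * _)](_ : _ = 1) ?mul1r; last first.
    by rewrite mx2_1; congr mx2; field; rewrite ?e0 ?mu0.
  by rewrite mul_mx2 mx2_1; congr mx2; field; rewrite ?w0 ?rhoN0.
pose G := mx2 rho 1 0 1; pose G' := mx2 rho^-1 (- rho^-1) 0 1.
have GG' : G * G' = 1 by rewrite mul_mx2 mx2_1; congr mx2; field.
set B := rot_0_inf w * rot_1_lam lam e.
have GA : G * A = B * G.
  by rewrite /G /A /B !mul_mx2; congr mx2; field; rewrite ?mu0 ?rhoN0.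
have GAX k : G * A ^+ k = B ^+ k * G.
  elim: k => [|k IH]; first by rewrite !expr0 mulr1 mul1r.
  by rewrite [A ^+ _]exprSr [B ^+ _]exprSr mulrA IH -mulrA GA mulrA.
have [_ char0 _ _ [d [b b_span]]] := padic.
have fin := finite_residues p_pr char0 abs_na b_span.
(* Conjugating back by [G] costs at most a factor [1 / |rho|]; the half makes the final inequality
   strict. *)
have c0 : (0 < eps * abs rho / 2)%Re by nra.
have [N N0 hN] := integral_pow_near1 p_pr abs_na fin c0
  (bM _ _ (bS _ w1 erefl) (bT _ e1 erefl)) (bM _ _ (bT _ eV1 eVE) (bS _ wV1 wVE)) AA'.
exists N => // i j.
have BE : B ^+ N - 1 = G * (A ^+ N - 1) * G'.
  by rewrite mulrBr mulr1 mulrBl GAX -mulrA GG' mulr1.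
have bG : mx_bounded abs 1 G by apply: bounded2; rewrite // absN.
have rV : (1 <= / abs rho)%Re by rewrite -Rinv_1; apply: Rinv_le_contravar; lra.
have bG' : mx_bounded abs (/ abs rho) G'.
  apply: bounded2; rewrite ?(absN abs_na) ?(absV abs_na) ?(abs0 abs_na) ?(abs1 abs_na) //; lra.
rewrite BE; set X := _ - 1 in hN *.
have c0' : (0 <= eps * abs rho / 2)%Re by lra.
have := mx_boundedM abs_na Rle_0_1 c0' bG hN; rewrite Rmult_1_l => hGX.
have rV0 : (0 <= / abs rho)%Re by lra.
apply: Rle_lt_trans (mx_boundedM abs_na c0' rV0 hGX bG' i j) _.
have -> : (eps * abs rho / 2 * / abs rho = eps / 2)%Re.
  by rewrite /Rdiv 2!Rmult_assoc (Rmult_comm (/ 2)) -(Rmult_assoc (abs rho)) Rinv_r; lra.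
lra.
Qed.

Lemma discrete_free_product_bound (s t : 'M[K]_2) :
  s \in unitmx -> t \in unitmx -> pgl_order s m -> pgl_order t n ->
  fixed_pts_0_inf s -> fixed_pts_1_lam t lam ->
  discrete_gen abs s t -> free_prod_via s t m n ->
  (abs (lam - 1) < alpha_p abs p zp m n)%Re.
Proof.
move=> us ut [_ sm _] [_ tn _] fs ft [eps [eps0 disc]] free.
have rm := unity_radius_gt0_le1 p_pr abs_na zp_m.
have rn := unity_radius_gt0_le1 p_pr abs_na zp_n.
rewrite alpha_pE; case: (eqVneq lam 1) => [->|lam1].
  by rewrite subrr (abs0 abs_na); apply: Rmult_lt_0_compat; tauto.
apply: Rnot_le_lt => hlam.
have [c [w [c0 sE]]] := fixed_pts_0_infE us fs.
have [c' [e [c0' tE]]] := fixed_pts_1_lamE lam1 ut ft.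
have w1 : w ^+ m = 1.
  move: sm; rewrite sE exprZn rot_0_infX proj_eqZ ?expf_neq0 //.
  exact: rot_0_inf_scalar.
have e1 : e ^+ n = 1.
  move: tn; rewrite tE exprZn (rot_1_lamX lam1) proj_eqZ ?expf_neq0 //.
  exact: rot_1_lam_scalar.
have [i hi wi] := unity_root_near p_pr abs_na zp_m m2 w1.
have [j hj ej] := unity_root_near p_pr abs_na zp_n n2 e1.
(* With [|rho| = r_m], [w ^+ i] lies within [|rho|] of 1, and [|e ^+ j - 1| |rho| <= r_n r_m <= |lam
   - 1|]. *)
pose rho := (1 - zp) ^+ eps_p p m.
have rhoE : abs rho = unity_radius abs p zp m by rewrite (absX abs_na).
have aw : abs (w ^+ i) = 1%Re.
  by rewrite (absX abs_na) (abs_unity_root abs_na (ltnW m2) w1) pow1.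
have ae : abs (e ^+ j) = 1%Re.
  by rewrite (absX abs_na) (abs_unity_root abs_na (ltnW n2) e1) pow1.
have [N N0 hN] : exists2 N, (0 < N)%N & forall i' j',
    (abs (((rot_0_inf (w ^+ i) * rot_1_lam lam (e ^+ j)) ^+ N - 1) i' j') < eps)%Re.
  apply: (rotation_product_pow_near1 (rho := rho)); rewrite ?rhoE //.
  apply: Rle_trans hlam; rewrite Rmult_comm; apply: Rmult_le_compat_l => //; lra.
have wordE : eval_word s t (alternating_word N i j) =
    (c ^+ i * c' ^+ j) ^+ N *: (rot_0_inf (w ^+ i) * rot_1_lam lam (e ^+ j)) ^+ N.
  rewrite eval_alternating_word sE tE !exprZn rot_0_infX (rot_1_lamX lam1).
  by rewrite -scalerAl -scalerAr scalerA exprZn.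
have C0 : (c ^+ i * c' ^+ j) ^+ N != 0 by rewrite expf_neq0 // mulf_neq0 // expf_neq0.
apply: (free (alternating_word N i j)); first exact: reduced_alternating_word.
(* Dividing by the accumulated scalar puts the word within [eps] of the identity, so discreteness
   makes it scalar. *)
apply: disc; exists ((c ^+ i * c' ^+ j) ^+ N)^-1; split; first by rewrite invr_neq0.
move=> i' j'; move: (hN i' j'); rewrite wordE; set X := _ ^+ N.
by rewrite !mxE mulKf // mulr_natl.
Qed.

End Necessity.

(** * Reduction of words *)

Section NormalForm.
Variables (K : fieldType) (A B : 'M[K]_2) (m n : nat).
Hypotheses (m0 : (0 < m)%N) (n0 : (0 < n)%N) (Am : A ^+ m = 1) (Bn : B ^+ n = 1).

(** Discreteness concerns all words, ping-pong only reduced ones. Letters are added on the left: the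
    exponent is taken modulo the order and merged with a leading letter of the same factor, and the
    letter disappears if the exponent becomes 0. *)
Lemma word_normal_form w : exists2 w', eval_word A B w' = eval_word A B w
  & w' = [::] \/ reduced_word m n w'.
Proof.
pose g b := if b then A else B; pose o b := if b then m else n.
have go b : g b ^+ o b = 1 by case: b.
have o0 b : (0 < o b)%N by case: b.
have gmod b k : g b ^+ (k %% o b) = g b ^+ k.
  by rewrite {2}(divn_eq k (o b)) exprD mulnC exprM go expr1n mul1r.
pose ok (x : bool * nat) := (0 < x.2 < o x.1)%N.
have okE x : (if x.1 then 0 < x.2 < m else 0 < x.2 < n)%N = ok x by rewrite /ok /o; case: x.1.
pose alt := fun a b : bool * nat => a.1 != b.1.
suff [w' e [sw aw]] : exists2 w', eval_word A B w' = eval_word A B w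
    & sorted alt w' /\ all ok w'.
  exists w' => //; case: w' sw aw {e} => [|x w'] sw aw; [by left | right; split=> //].
  by rewrite (eq_all okE).
elim: w => [|[b k] w [w' e [sw aw]]]; first by exists [::].
have cons_nf c l v : (0 < l < o c)%N -> (forall y u, v = y :: u -> c != y.1) ->
    sorted alt v -> all ok v -> sorted alt ((c, l) :: v) /\ all ok ((c, l) :: v).
  move=> hl hv sv av; split; last by rewrite /= av andbT.
  by case: v hv sv {av} => //= y u hv sv; rewrite sv andbT; apply: (hv y u).
rewrite eval_word_cons -e -/(g b) -gmod /=.
have kb : (k %% o b < o b)%N by rewrite ltn_mod.
move: (k %% o b)%N kb => {}k kb.
have [->|k0] := posnP k; first by exists w'; rewrite ?expr0 ?mul1r.
case: w' sw aw {e} => [|[b' k'] w'] sw aw.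
  exists [:: (b, k)]; first by rewrite eval_word_cons.
  by apply: cons_nf; rewrite ?k0.
have [bb'|bb'] := eqVneq b b'; last first.
  exists [:: (b, k), (b', k') & w']; first by rewrite [in LHS]eval_word_cons.
  by apply: cons_nf; rewrite ?k0 // => y u [<- _].
subst b'; have sw' := path_sorted sw; have aw' : all ok w' by case/andP: aw.
have [l0|l0] := posnP ((k + k') %% o b).
  exists w'; last by [].
  by rewrite eval_word_cons mulrA -/(g b) -exprD -gmod l0 expr0 mul1r.
exists ((b, (k + k') %% o b) :: w')%N.
  by rewrite !eval_word_cons mulrA -/(g b) -exprD gmod.
apply: cons_nf => //; first by rewrite l0 ltn_mod o0.
by move=> y u e; move: sw; rewrite e /= => /andP [].
Qed.

End NormalForm.

(** * Ping-pong on the projective line *)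

Section PingPong.
Variables (K : fieldType) (abs : K -> Real) (p m n : nat) (lam w e : K) (rm rn : Real).
Hypothesis abs_na : is_nonarch_abs abs p.
Hypotheses (lam1 : lam != 1) (rm01 : (0 < rm <= 1)%Re) (rn01 : (0 < rn <= 1)%Re).
Hypothesis lam_near1 : (abs (lam - 1) < rm * rn)%Re.
Hypotheses (w_unit : abs w = 1%Re) (e_unit : abs e = 1%Re).
Hypothesis w_far : forall i, (0 < i < m)%N -> (rm <= abs (w ^+ i - 1))%Re.
Hypothesis e_far : forall i, (0 < i < n)%N -> (rn <= abs (e ^+ i - 1))%Re.

Let d := abs (lam - 1).
Let d0 : (0 < d)%Re. Proof. by apply: (abs_gt0 abs_na); rewrite subr_eq0. Qed.
Let d_lt : (d < rm)%Re. Proof. by have := lam_near1; rewrite -/d; nra. Qed.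

(** The Moebius action lifted to homogeneous coordinates, so that oo, as [(1, 0)], needs no separate
    case. *)
Definition act (A : 'M[K]_2) (v : K * K) : K * K :=
  (A ord0 ord0 * v.1 + A ord0 ord_max * v.2, A ord_max ord0 * v.1 + A ord_max ord_max * v.2).

Lemma actM A B v : act (A * B) v = act A (act B v).
Proof.
rewrite /act !mxE !big_ord_recl !big_ord0 !addr0 (_ : lift ord0 ord0 = ord_max).
  by congr (_, _); rewrite /=; ring.
exact: val_inj.
Qed.

(* In the coordinate z = x / y, [near1] is the disc |z - 1| < rm. *)
Definition near1 (v : K * K) : Prop := (abs (v.1 - v.2) < rm * abs v.2)%Re.

(** The complement of the disc [near1], oo included; the strict inequality excludes only the zero
    vector. *)
Definition off1 (v : K * K) : Prop :=
  (rm * abs v.2 <= abs (v.1 - v.2) /\ 0 < abs (v.1 - v.2))%Re.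

(* Where a reduced word with leftmost letter s ([b = true]) or t ([b = false])
   sends its starting point, oo or 1. *)
Definition landing (b : bool) (v : K * K) : Prop :=
  if b then (rm * abs v.2 <= abs (v.1 - v.2) <= abs v.2 /\ 0 < abs v.2)%Re
  else (d * abs v.2 <= abs (v.1 - v.2) < rm * abs v.2)%Re.

(** In [w^i x - y = w^i (x - y) + (w^i - 1) y] the second term dominates, because
    [|x - y| < rm |y| <= |w^i - 1| |y|]. *)
Lemma rot_0_inf_ping v i : (0 < i < m)%N -> near1 v ->
  landing true (act (rot_0_inf w ^+ i) v).
Proof.
case: v => x y /w_far hw; rewrite /near1 rot_0_infX /landing /act.
have [-> -> -> ->] := mx2E (w ^+ i) 0 0 1; rewrite /= !mul0r add0r addr0 mul1r => h.
have wi : abs (w ^+ i) = 1%Re by rewrite (absX abs_na) w_unit pow1.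
have w1 : (abs (w ^+ i - 1) <= 1)%Re.
  by apply: (absB_le abs_na); rewrite ?wi ?(abs1 abs_na); lra.
have y0 : (0 <= abs y)%Re := abs_ge0 abs_na y.
have a0 := abs_ge0 abs_na (x - y).
have -> : abs (w ^+ i * x - y) = (abs (w ^+ i - 1) * abs y)%Re.
  rewrite -(absM abs_na) -[RHS](absD_dom abs_na (x := w ^+ i * (x - y))).
    by congr abs; ring.
  by rewrite !(absM abs_na) wi; nra.
by split; [split; nra | nra].
Qed.

(** The map preserves [x - y] and sends [y] to [k (x - y) + e^j y]. Since [|k| d = |e^j - 1| >= rn]
    and [d < rm rn], one has [rm |k| > 1], so the first term dominates and the image has
    [|z - 1| = 1 / |k|], between [d] and [rm]. *)
Lemma rot_1_lam_pong v j : (0 < j < n)%N -> off1 v ->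
  landing false (act (rot_1_lam lam e ^+ j) v).
Proof.
case: v => x y /e_far he; rewrite /off1 (rot_1_lamX lam1) /landing /act /rot_1_lam.
set k := (e ^+ j - 1) / (1 - lam).
have [-> -> -> ->] := mx2E (1 + k) (e ^+ j - 1 - k) k (e ^+ j - k).
rewrite /= => -[h a0].
have ej : abs (e ^+ j) = 1%Re by rewrite (absX abs_na) e_unit pow1.
have e1 : (abs (e ^+ j - 1) <= 1)%Re.
  by apply: (absB_le abs_na); rewrite ?ej ?(abs1 abs_na); lra.
have -> : (1 + k) * x + (e ^+ j - 1 - k) * y - (k * x + (e ^+ j - k) * y) = x - y by ring.
have kd : (abs k * d = abs (e ^+ j - 1))%Re.
  by rewrite /d (absB abs_na) -(absM abs_na) divfK // subr_eq0 eq_sym.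
have y0 := abs_ge0 abs_na y; have k0 := abs_ge0 abs_na k.
have rk : (1 < rm * abs k)%Re.
  apply: (Rmult_lt_reg_r d) => //; rewrite Rmult_1_l Rmult_assoc kd.
  apply: Rlt_le_trans lam_near1 _; apply: Rmult_le_compat_l => //; lra.
have ka : (abs (x - y) < rm * (abs k * abs (x - y)))%Re by nra.
have -> : abs (k * x + (e ^+ j - k) * y) = (abs k * abs (x - y))%Re.
  rewrite -(absM abs_na) -[RHS](absD_dom abs_na (x := e ^+ j * y)).
    by congr abs; ring.
  by rewrite (absM abs_na k) (absM abs_na) ej Rmult_1_l; apply: (Rmult_lt_reg_l rm); lra.
split=> //; rewrite -Rmult_assoc (Rmult_comm d) kd; nra.
Qed.

(** Letters act from right to left: the landing region of each letter lies in the region from which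
    the other letter plays. *)
Lemma reduced_word_landing x u :
  sorted (fun a b : bool * nat => a.1 != b.1) (x :: u) ->
  all (fun x : bool * nat => if x.1 then (0 < x.2 < m)%N else (0 < x.2 < n)%N) (x :: u) ->
  exists b : bool, landing x.1
    (act (eval_word (rot_0_inf w) (rot_1_lam lam e) (x :: u)) (if b then (1, 1) else (1, 0))).
Proof.
have step v y : (if y.1 then near1 v else off1 v) ->
    (if y.1 then (0 < y.2 < m)%N else (0 < y.2 < n)%N) ->
    landing y.1 (act ((if y.1 then rot_0_inf w else rot_1_lam lam e) ^+ y.2) v).
  by case: y => [[]] k /= hv hk; [apply: rot_0_inf_ping | apply: rot_1_lam_pong].
elim: u x => [|y u IH] x.
  (* A rightmost [s] starts from 1, which is in [near1]; a rightmost [t] starts from oo, which is in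
     [off1]. *)
  move=> _; rewrite /= andbT => hx; exists x.1.
  rewrite eval_word_cons eval_word_nil mulr1; apply: step => //.
  rewrite /near1 /off1; case: (x.1) => /=.
    by rewrite subrr (abs0 abs_na) (abs1 abs_na); lra.
  by rewrite subr0 (abs0 abs_na) (abs1 abs_na); lra.
move=> /= /andP [xy su] /andP [hx hu]; have [b hb] := IH y su hu; exists b.
rewrite eval_word_cons actM; move: (act (eval_word _ _ _) _) hb => v hb.
apply: step => //; move: xy hb; rewrite /landing; case: (x.1); case: (y.1) => //= _.
- by case.
- by rewrite /off1 => -[[h1 h2] h3]; split=> //; nra.
Qed.

(** A matrix within [d] of the identity moves 1 and oo too little for their images to lie in either
    landing region. *)
Lemma reduced_word_far1 u c : reduced_word m n u ->
  ~ (forall i j : 'I_2,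
      (abs (c * (eval_word (rot_0_inf w) (rot_1_lam lam e) u) i j - (i == j)%:R) < d)%Re).
Proof.
case: u => [|x u] []// _ su au H; have [b] := reduced_word_landing su au.
set W := eval_word _ _ _ in H *.
have h00 : (abs (c * W ord0 ord0 - 1) < d)%Re := H ord0 ord0.
have h11 : (abs (c * W ord_max ord_max - 1) < d)%Re := H ord_max ord_max.
have := H ord0 ord_max; rewrite /= subr0 => h01.
have := H ord_max ord0; rewrite /= subr0 => h10.
have c0 : (0 < abs c)%Re.
  apply: (abs_gt0 abs_na); apply/eqP => e0; move: h00.
  by rewrite e0 mul0r sub0r (absN abs_na) (abs1 abs_na); lra.
have near_one z : (abs (z - 1) < d)%Re -> abs z = 1%Re.
  move=> h; have h' : (abs (z - 1) < abs 1)%Re by rewrite (abs1 abs_na); lra.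
  by rewrite -(subrK 1 z) (absD_dom abs_na h') (abs1 abs_na).
have scale v b' : landing b' v -> landing b' (c * v.1, c * v.2).
  rewrite /landing /= -mulrBr !(absM abs_na).
  move: (abs (v.1 - v.2)) (abs v.2) (abs c) c0 => a y C C0; case: b' => [[[h1 h2] h3]|[h1 h2]].
    by split; [split; nra | nra].
  by split; nra.
(* Starting from 1, the image has [|y'| = 1] and [|x' - y'| < d], while both regions require at
   least [d |y'|]. *)
move=> /scale; rewrite /act; case: b => /=.
  set x' := c * _; set y' := c * _ => hl.
  have xE : x' = c * W ord0 ord0 + c * W ord0 ord_max by rewrite /x'; ring.
  have yE : y' = c * W ord_max ord0 + c * W ord_max ord_max by rewrite /y'; ring.
  have y1 : abs y' = 1%Re.
    by rewrite yE (absD_dom abs_na) (near_one _ h11) //; lra.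
  have a1 : (abs (x' - y') < d)%Re.
    have -> : x' - y' = (c * W ord0 ord0 - 1) + c * W ord0 ord_max
         - (c * W ord_max ord0 + (c * W ord_max ord_max - 1)) by rewrite xE yE; ring.
    by apply: (absB_lt abs_na); apply: (absD_lt abs_na).
  move: hl a1; rewrite /landing /= y1; move: (abs (x' - y')) => a.
  by case: x.1 => [[[h1 h2] h3]|[h1 h2]] a1; lra.
(* Starting from oo, the image has [|x' - y'| = 1] and [|y'| < d < 1], while both regions require
   [|x' - y'| <= |y'|]. *)
rewrite !mulr0 !mulr1 !addr0 => hl.
have x1 := near_one _ h00; set x' := c * _ in x1 hl; set y' := c * _ in h10 hl.
have a1 : abs (x' - y') = 1%Re.
  have h' : (abs (- y') < abs x')%Re by rewrite (absN abs_na) x1; lra.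
  by rewrite addrC (absD_dom abs_na h').
by move: hl; rewrite /landing /= a1; case: x.1 => [[[h1 h2] h3]|[h1 h2]]; nra.
Qed.

End PingPong.

(** * Orders and fixed points of the model rotations *)

Section RotationProperties.
Variables (K : fieldType) (lam e : K) (k : nat).
Hypotheses (k2 : (2 <= k)%N) (e_prim : k.-primitive_root e) (lam1 : lam != 1).

Let e0 : e != 0.
Proof.
apply/eqP => h; move/eqP: (prim_expr_order e_prim).
by rewrite h expr0n eqn0Ngt (ltnW k2) eq_sym oner_eq0.
Qed.
Let e1 : e != 1. Proof. exact: prim_root_neq1 k2 e_prim. Qed.
Let mu0 : 1 - lam != 0. Proof. by rewrite subr_eq0 eq_sym. Qed.

Lemma proj_eq11 : proj_eq (1 : 'M[K]_2) 1.
Proof. by exists 1; rewrite oner_neq0 scale1r. Qed.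

Lemma prim_root_expr_neq1 j : (0 < j < k)%N -> e ^+ j != 1.
Proof.
case/andP => j0 jk; rewrite -(prim_order_dvd e_prim); apply/negP => /(dvdn_leq j0).
by rewrite leqNgt jk.
Qed.

Lemma rot_0_inf_unit : rot_0_inf e \in unitmx.
Proof. by rewrite unitmxE det_mx2 mulr0 subr0 mulr1 unitfE. Qed.

Lemma rot_0_inf_order : pgl_order (rot_0_inf e) k.
Proof.
split=> [||j hj]; first exact: ltnW.
  by rewrite rot_0_infX (prim_expr_order e_prim) /rot_0_inf -mx2_1; apply: proj_eq11.
by rewrite rot_0_infX => /rot_0_inf_scalar/eqP; rewrite (negPf (prim_root_expr_neq1 hj)).
Qed.

Lemma rot_0_inf_fixed : fixed_pts_0_inf (rot_0_inf e).
Proof.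
rewrite /fixed_pts_0_inf /fixes; have [-> -> -> ->] := mx2E e 0 0 1; split.
  by exists e; split; ring.
move=> z; split=> [[c [h1 h2]]|->]; last by exists 1; split; ring.
have cE : c = 1 by move: h2; rewrite mul0r add0r !mulr1.
have /eqP : (e - 1) * z = 0 by rewrite mulrBl mul1r -[e * z]addr0 -{1}(mul0r 1) h1 cE mul1r subrr.
by rewrite mulf_eq0 subr_eq0 (negPf e1) => /eqP.
Qed.

Lemma rot_1_lam_unit : rot_1_lam lam e \in unitmx.
Proof.
rewrite unitmxE det_mx2 unitfE (_ : _ - _ = e) //; by ring.
Qed.

Lemma rot_1_lam_order : pgl_order (rot_1_lam lam e) k.
Proof.
split=> [||j hj]; first exact: ltnW.
  (* [rot_1_lam lam 1] is seen to be the identity by reading it as a zeroth power. *)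
  rewrite (rot_1_lamX lam1) (prim_expr_order e_prim) -(expr0 1) -(rot_1_lamX lam1) expr0.
  exact: proj_eq11.
rewrite (rot_1_lamX lam1) => /(rot_1_lam_scalar lam1)/eqP.
by rewrite (negPf (prim_root_expr_neq1 hj)).
Qed.

Lemma rot_1_lam_fixed : fixed_pts_1_lam (rot_1_lam lam e) lam.
Proof.
rewrite /fixed_pts_1_lam /fixes /rot_1_lam; set q := (e - 1) / (1 - lam).
have [-> -> -> ->] := mx2E (1 + q) (e - 1 - q) q (e - q).
have q0 : q != 0 by rewrite mulf_neq0 ?invr_neq0 // subr_eq0.
have eE : e = 1 + q * (1 - lam) by rewrite /q divfK // addrC subrK.
split=> [[c [_]]|z].
  by rewrite mulr1 mulr0 addr0 mulr0 => /eqP; rewrite (negPf q0).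
split=> [[c []]|].
  rewrite !mulr1 => + cE; rewrite -cE eE => h.
  (* Eliminating the eigenvalue turns the fixed point condition into this quadratic equation. *)
  have : q * ((z - 1) * (z - lam)) = 0.
    have -> : q * ((z - 1) * (z - lam)) = (q * z + (1 + q * (1 - lam) - q)) * z
        - ((1 + q) * z + (1 + q * (1 - lam) - 1 - q)) by ring.
    by rewrite h subrr.
  move/eqP; rewrite mulf_eq0 (negPf q0) /= mulf_eq0 !subr_eq0.
  by case/orP => /eqP; [left | right].
case=> ->; [exists e | exists 1]; rewrite eE; split; ring.
Qed.

End RotationProperties.

(** * Sufficiency of the bound, and the equivalence *)

Lemma discrete_free_product_exists (K : fieldType) (abs : K -> Real) (p m n : nat) (zp lam : K) :
  prime p -> is_nonarch_abs abs p -> (2 <= m)%N -> (2 <= n)%N ->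
  (exists z : K, m.-primitive_root z) -> (exists z : K, n.-primitive_root z) ->
  (((p %| m) || (p %| n))%N -> p.-primitive_root zp) ->
  lam != 1 -> Rlt (abs (lam - 1)) (alpha_p abs p zp m n) ->
  exists s t : 'M[K]_2,
    [/\ s \in unitmx, t \in unitmx, pgl_order s m & pgl_order t n] /\
    [/\ fixed_pts_0_inf s, fixed_pts_1_lam t lam,
        discrete_gen abs s t & free_prod_via s t m n].
Proof.
move=> p_pr abs_na m2 n2 [w wP] [e eP] zp_prim lam1; rewrite alpha_pE => hlam.
have zp_m : (p %| m)%N -> p.-primitive_root zp by move=> h; apply: zp_prim; rewrite h.
have zp_n : (p %| n)%N -> p.-primitive_root zp by move=> h; apply: zp_prim; rewrite h orbT.
have m0 := ltnW m2; have n0 := ltnW n2.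
have rm := unity_radius_gt0_le1 p_pr abs_na zp_m.
have rn := unity_radius_gt0_le1 p_pr abs_na zp_n.
have w1 := abs_unity_root abs_na m0 (prim_expr_order wP).
have e1 := abs_unity_root abs_na n0 (prim_expr_order eP).
have far (r : nat) (z : K) : (0 < r)%N -> ((p %| r)%N -> p.-primitive_root zp) ->
    r.-primitive_root z -> forall i, (0 < i < r)%N ->
    Rle (unity_radius abs p zp r) (abs (z ^+ i - 1)).
  move=> r0 zp_r zr i hi; apply: (unity_root_far p_pr abs_na zp_r r0).
    by rewrite exprAC (prim_expr_order zr) expr1n.
  exact: prim_root_expr_neq1 zr _ hi.
have far1 := reduced_word_far1 abs_na lam1 rm rn hlam w1 e1 (far _ _ m0 zp_m wP)
  (far _ _ n0 zp_n eP).
have d0 : Rlt 0 (abs (lam - 1)) by apply: (abs_gt0 abs_na); rewrite subr_eq0.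
exists (rot_0_inf w), (rot_1_lam lam e); split; split.
- exact: rot_0_inf_unit wP.
- exact: rot_1_lam_unit eP.
- exact: rot_0_inf_order.
- exact: rot_1_lam_order.
- exact: rot_0_inf_fixed wP.
- exact: rot_1_lam_fixed eP lam1.
(* The isolating radius is [|lam - 1|]: no reduced word comes that close to 1, so the normal form of
   such a word is empty. *)
- exists (abs (lam - 1)); split=> // u [c [_ hc]].
  have sm : rot_0_inf w ^+ m = 1.
    by rewrite rot_0_infX (prim_expr_order wP) mx2_1.
  have tn : rot_1_lam lam e ^+ n = 1.
    by rewrite (rot_1_lamX lam1) (prim_expr_order eP) -(expr0 1) -(rot_1_lamX lam1) expr0.
  have [u' uE [u0|red]] := word_normal_form m0 n0 sm tn u.
    by rewrite -uE u0 eval_word_nil; apply: proj_eq11.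
  by case: (far1 u' c red); rewrite uE.
(* A scalar reduced word, rescaled by [c^-1], would be at distance 0 from the identity. *)
- move=> u red [c [c0 uE]]; apply: (far1 u c^-1 red) => i j.
  by rewrite uE !mxE mulKf // subrr (abs0 abs_na).
Qed.

Theorem mainTheorem4 (K : fieldType) (abs : K -> Real) (p m n : nat) (zp : K) :
  padic_field abs p ->
  (2 <= m)%N -> (2 <= n)%N ->
  (* K contains the needed roots of unity *)
  (exists z : K, m.-primitive_root z) ->
  (exists z : K, n.-primitive_root z) ->
  (((p %| m) || (p %| n))%N -> p.-primitive_root zp) ->
  (forall (s t : 'M[K]_2) (lam : K),
      s \in unitmx -> t \in unitmx ->
      pgl_order s m -> pgl_order t n ->
      fixed_pts_0_inf s -> fixed_pts_1_lam t lam ->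
      abs lam = R1 ->
      discrete_gen abs s t -> free_prod_via s t m n ->
      Rlt (abs (lam - 1)) (alpha_p abs p zp m n))
  /\
  (forall lam : K,
      abs lam = R1 -> lam != 1 ->
      Rlt (abs (lam - 1)) (alpha_p abs p zp m n) ->
      exists s t : 'M[K]_2,
        [/\ s \in unitmx, t \in unitmx, pgl_order s m & pgl_order t n] /\
        [/\ fixed_pts_0_inf s, fixed_pts_1_lam t lam,
            discrete_gen abs s t & free_prod_via s t m n]).
Proof.
move=> padic m2 n2 wm wn zp_prim; split.
  move=> s t lam us ut om on fs ft _; exact: discrete_free_product_bound.
move=> lam _; have [p_pr _ abs_na _ _] := padic.
exact: discrete_free_product_exists.
Qed.
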